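(* Let $\delta,\rho,H>0$ satisfy $1<\frac{\rho}{\delta+H}\leq e$ and put $\kappa=\ln\left(\frac{\rho}{\delta+H}\right)$. Let $\sigma_0>0$ be the unique number satisfying $H\sigma_0e^{1+\delta\sigma_0}=1$, and let $r_*>0$ be the spectral threshold defined in the context. Suppose that $$0<\sigma\leq\sigma_0,\qquad 0<r<r_*.$$ If $\sigma<r$, assume in addition that $H>\rho e^{2\lambda(\sigma-r)}$, where $\lambda>0$ is the unique positive root of $$-\lambda-\delta-He^{-\sigma\lambda}+\rho e^{-r\lambda}=0.$$ Then there exists $c^*>0$ such that, for every $c>c^*$, the equation $$n_t(t,x)=n_{xx}(t,x)-\delta n(t,x)-H n(t-\sigma,x)+\rho n(t-r,x)e^{-n(t-r,x)}$$ admits a traveling wave solution $n(t,x)=\phi(x+ct)$ connecting the trivial equilibrium $0$ to the positive equilibrium $\kappa$; more precisely, $$\lim_{s\to-\infty}\phi(s)=0,\qquad \lim_{s\to+\infty}\phi(s)=\kappa.$$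
   Context: Here $t,x\in\mathbb R$ (one space dimension), and a traveling wave solution with speed $c>0$ is a solution of the form $n(t,x)=\phi(x+ct)$, i.e. the profile $\phi:\mathbb R\to\mathbb R$ satisfies $$c\phi'(s)=\phi''(s)-\delta\phi(s)-H\phi(s-c\sigma)+\rho\phi(s-cr)e^{-\phi(s-cr)},\qquad s\in\mathbb R.$$ Definition of $r_*$. Set $$\omega_-=\sqrt{(\rho-H)^2-\delta^2},\qquad \omega_+=\sqrt{(\rho+H)^2-\delta^2}$$ (since $\rho>\delta+H$, $\omega_->0$). For $\omega\in[\omega_-,\omega_+]$ set $$R(\omega)=\sqrt{\delta^2+\omega^2},\qquad \alpha(\omega)=\arctan\left(\frac{\omega}{\delta}\right),\qquad \beta_\rho(\omega)=\arccos\left(\frac{\rho^2-H^2+R(\omega)^2}{2\rho R(\omega)}\right).$$ Then $$r_*=\min_{\omega\in[\omega_-,\omega_+]}\frac{2\pi-\alpha(\omega)-\beta_\rho(\omega)}{\omega}.$$ *)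

(* Defs.v *)
From Stdlib Require Import Reals Lra.
From Coquelicot Require Import Coquelicot.
Open Scope R_scope.

(** [Derive] and [Derive_n] are total, and [ex_derive_n f 2 x] only says that
    the total function [Derive f] is differentiable at [x]; hence the separate
    clause [ex_derive (n t) x]. *)
Definition solution (delta rho H sigma r : R) (n : R -> R -> R) : Prop :=
  forall t x : R,
    ex_derive (fun t' => n t' x) t /\
    ex_derive (n t) x /\
    ex_derive_n (n t) 2 x /\
    Derive (fun t' => n t' x) t =
      Derive_n (n t) 2 x - delta * n t x - H * n (t - sigma) x
      + rho * n (t - r) x * exp (- n (t - r) x).

Definition traveling_wave (delta rho H sigma r c : R) (phi : R -> R) : Prop :=
  solution delta rho H sigma r (fun t x => phi (x + c * t)).

Definition profile_equation (delta rho H sigma r c : R) (phi : R -> R) : Prop :=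
  forall s : R,
    ex_derive phi s /\
    ex_derive_n phi 2 s /\
    c * Derive phi s =
      Derive_n phi 2 s - delta * phi s - H * phi (s - c * sigma)
      + rho * phi (s - c * r) * exp (- phi (s - c * r)).

Lemma traveling_wave_profile (delta rho H sigma r c : R) (phi : R -> R) :
  traveling_wave delta rho H sigma r c phi <->
  profile_equation delta rho H sigma r c phi.
Proof.
assert (Dt : forall t x : R, ex_derive phi (x + c * t) ->
  is_derive (fun t' : R => phi (x + c * t')) t (c * Derive phi (x + c * t))).
{ intros t x Hp.
  apply (is_derive_comp phi (fun t' => x + c * t')).
  - now apply Derive_correct.
  - auto_derive; [easy | ring]. }
assert (Dx : forall a x, ex_derive phi (x + a) ->
  is_derive (fun y => phi (y + a)) x (Derive phi (x + a))).
{ intros a x Hp.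
  replace (Derive phi (x + a)) with (scal 1 (Derive phi (x + a)))
    by (unfold scal; simpl; unfold mult; simpl; ring).
  apply (is_derive_comp phi (fun y => y + a)).
  - now apply Derive_correct.
  - auto_derive; [easy | ring]. }
split.
- intros W s.
  assert (E : forall y, phi (y + c * 0) = phi y)
    by (intros y; f_equal; ring).
  destruct (W 0 s) as (_ & D1 & D2 & Eq).
  assert (P1 : ex_derive phi s) by (revert D1; now apply ex_derive_ext).
  assert (P2 : ex_derive_n phi 2 s) by (revert D2; now apply ex_derive_n_ext).
  split; [easy |]. split; [easy |].
  cbv beta in Eq.
  rewrite (Derive_n_ext _ phi 2 s E) in Eq.
  assert (P1' : ex_derive phi (s + c * 0))
    by (now replace (s + c * 0) with s by ring).
  rewrite (is_derive_unique (fun t' : R => phi (s + c * t')) _ _ (Dt 0 s P1')) in Eq.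
  replace (s + c * 0) with s in Eq by ring.
  replace (s + c * (0 - sigma)) with (s - c * sigma) in Eq by ring.
  replace (s + c * (0 - r)) with (s - c * r) in Eq by ring.
  exact Eq.
- intros P t x.
  assert (P1 : forall s, ex_derive phi s) by (intros s; apply P).
  assert (E : forall y,
    Derive (fun z => phi (z + c * t)) y = Derive phi (y + c * t))
    by (intros y; apply is_derive_unique, Dx, P1).
  destruct (P (x + c * t)) as (_ & P2 & Eq).
  assert (D2 : is_derive (Derive (fun z => phi (z + c * t))) x
                 (Derive_n phi 2 (x + c * t))).
  { apply is_derive_ext with (fun y => Derive phi (y + c * t));
      [now intros y |].
    replace (Derive_n phi 2 (x + c * t))
      with (scal 1 (Derive_n phi 2 (x + c * t)))
      by (unfold scal; simpl; unfold mult; simpl; ring).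
    apply (is_derive_comp (Derive phi) (fun y => y + c * t)).
    - now apply Derive_correct.
    - auto_derive; [easy | ring]. }
  cbv beta. split; [| split; [| split]].
  + eexists. apply Dt, P1.
  + eexists. apply Dx, P1.
  + eexists. exact D2.
  + rewrite (is_derive_unique _ _ _ (Dt t x (P1 _))).
    change (Derive_n (fun z => phi (z + c * t)) 2 x)
      with (Derive (Derive (fun z => phi (z + c * t))) x).
    rewrite (is_derive_unique _ _ _ D2), Eq.
    replace (x + c * (t - sigma)) with (x + c * t - c * sigma) by ring.
    replace (x + c * (t - r)) with (x + c * t - c * r) by ring.
    reflexivity.
Qed.

Definition kappa (delta rho H : R) : R := ln (rho / (delta + H)).

Definition omega_minus (delta rho H : R) : R := sqrt ((rho - H)^2 - delta^2).
Definition omega_plus (delta rho H : R) : R := sqrt ((rho + H)^2 - delta^2).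

Definition Romega (delta omega : R) : R := sqrt (delta^2 + omega^2).
Definition alpha (delta omega : R) : R := atan (omega / delta).

(** Stdlib's [acos] is constant outside [[-1, 1]].  For [0 < H < rho] the
    argument below lies in that interval exactly when
    [rho - H <= Romega delta omega <= rho + H] (law of cosines), which is
    [omega_minus <= omega <= omega_plus] when [omega >= 0] and
    [delta < rho - H]. *)
Definition beta (delta rho H omega : R) : R :=
  acos ((rho^2 - H^2 + (Romega delta omega)^2)
        / (2 * rho * Romega delta omega)).

Definition is_minimum_on (f : R -> R) (a b m : R) : Prop :=
  (exists w : R, a <= w <= b /\ f w = m) /\
  (forall w : R, a <= w <= b -> m <= f w).

Definition is_r_star (delta rho H rstar : R) : Prop :=
  is_minimum_on
    (fun omega => (2 * PI - alpha delta omega - beta delta rho H omega) / omega)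
    (omega_minus delta rho H) (omega_plus delta rho H) rstar.

(* Main.v *)
Require Import Defs.
From Stdlib Require Import Reals Lra.
From Coquelicot Require Import Coquelicot.
Open Scope R_scope.

(** The wave is monotone, and it is obtained as a fixed point of a monotone map.

    Two features of the parameters make the equation monotone.  Since
    [1 < rho / (delta + H) <= exp 1], the equilibrium satisfies [0 < kappa <= 1],
    and [x * exp (- x)] is increasing on [0 <= x <= 1], so that the birth term grows
    with the profile as long as the latter has values between [0] and [kappa].  The
    term [- H n (t - sigma)] has the wrong sign, but the bound [sigma <= sigma0]
    makes it harmless: for the equation without diffusion it says that the linear
    part [y' = - delta y - H y (t - sigma)] is non-oscillatory.  With [a = c * sigma] and [b = c * r], the function
    [z ^ 2 - c * z - delta - H * exp (- a * z)] has a negative root [- m]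
    ([exists_stable_root]), and dividing by the factor [z + m] turns the profile
    equation into the first-order system
<<
      phi' = - m phi + w,
      w'   = (c + m) w - feedback phi,
      feedback phi s = rho phi(s - b) exp(- phi(s - b))
                       + H (exp(m a) phi(s) - phi(s - a)).
>>
    If [w] grows, then [s |-> exp(m s) * (change of phi)] is nondecreasing, so
    [exp(m a) phi(s) - phi(s - a)] grows as well.  Hence the map taking [w] to the
    bounded solution [phi] of the first equation, and then to the bounded
    solution [v] of the second one with that [phi], is monotone ([stage_monotone]).

    If [c > 2 * sqrt rho], then the characteristic function of the linearisation
    at [0] is negative at [0] and positive at [c / 2].  At its last zero [lam] in
    between, and at some [mu] with [lam < mu <= 2 * lam] to the right of it,
    exponentials give the classical barriers: the map preserves the set of nondecreasing, uniformly
    Lipschitz [w] that satisfy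
<<
      (lam + m) exp(lam s) - M (mu + m) exp(mu s) <= w s <= (lam + m) exp(lam s)
>>
    and [0 <= w <= m * kappa] ([stage_upper], [stage_lower], [stage_slope]).  This
    set is closed under pointwise infima, so the Knaster-Tarski argument gives a
    fixed point ([fixed_point_of_monotone_relation]) and passing to the limit
    under integrals is avoided altogether.

    The profile then lies below [exp (lam * s)], which gives the limit [0] at
    minus infinity.  It is nondecreasing and not identically zero, so it has a
    positive limit at plus infinity; there the derivatives tend to [0], hence the
    limit solves [rho * exp (- l) = delta + H], that is, [l = kappa]
    ([stage_limit]). *)

(** * Auxiliary facts on real functions *)

Lemma exp_nondecreasing (x y : R) : x <= y -> exp x <= exp y.
Proof. intros [L | ->]; [left; now apply exp_increasing | apply Rle_refl]. Qed.

Lemma delayed_exp (z t d : R) : exp (z * (t - d)) = exp (z * t) * exp (- (z * d)).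
Proof. rewrite <- exp_plus. f_equal. ring. Qed.

Lemma derive_continuous (f : R -> R) (t l : R) :
  is_derive f t l -> continuous f t.
Proof. intros D. apply (ex_derive_continuous (V := R_NormedModule)). now exists l. Qed.

Lemma nondecreasing_of_derive (f df : R -> R) :
  (forall t, is_derive f t (df t)) -> (forall t, 0 <= df t) ->
  forall s t, s <= t -> f s <= f t.
Proof.
  intros D P s t st.
  destruct (MVT_gen f s t df) as (x & _ & E).
  - intros x _; apply D.
  - intros x _. apply continuity_pt_filterlim.
    apply (derive_continuous _ _ _ (D x)).
  - assert (0 <= df x * (t - s)) by (apply Rmult_le_pos; [apply P | lra]).
    lra.
Qed.

(** The zero is the supremum of the points where [f <= 0]; what matters is that [f]
    is positive immediately to the right of it. *)
Lemma last_sign_change (f : R -> R) (b : R) :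
  (forall x, continuity_pt f x) -> 0 < b -> f 0 < 0 -> 0 < f b ->
  exists x, 0 < x < b /\ f x = 0 /\ forall y, x < y <= b -> 0 < f y.
Proof.
  intros C b0 f0 fb.
  assert (loc : forall x, f x <> 0 -> exists e, 0 < e /\ forall y, Rabs (y - x) < e -> 0 < f x * f y).
  { intros x nz. destruct (C x (Rabs (f x))) as (e & e0 & He).
    - now apply Rabs_pos_lt.
    - exists e. split; [easy |]. intros y yx.
      destruct (Req_dec x y) as [<- | ne]; [nra |].
      assert (A : Rabs (f y - f x) < Rabs (f x)).
      { apply He. split; [split; [exact I | easy] | exact yx]. }
      unfold Rabs in A. destruct (Rcase_abs (f y - f x)), (Rcase_abs (f x)); nra. }
  destruct (completeness (fun x => 0 <= x <= b /\ f x <= 0)) as (x & ub & least).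
  - exists b. intros y Y; apply Y.
  - exists 0. lra.
  - assert (x0 : 0 <= x) by (apply ub; lra).
    assert (xb : x <= b) by (apply least; intros y Y; apply Y).
    assert (zero : f x = 0).
    { destruct (Req_dec (f x) 0) as [|nz]; [easy | exfalso].
      destruct (loc x nz) as (e & e0 & He).
      destruct (Rlt_or_le (f x) 0) as [neg | pos].
      - assert (x < b) by (destruct xb as [| ->]; lra).
        set (y := Rmin b (x + e / 2)).
        assert (xy : x < y) by (apply Rmin_glb_lt; lra).
        assert (ye : y <= x + e / 2) by apply Rmin_r.
        assert (yb : y <= b) by apply Rmin_l.
        assert (P := He y ltac:(rewrite Rabs_pos_eq; lra)).
        assert (y <= x) by (apply ub; split; [lra | nra]). lra.
      - assert (x <= x - e / 2); [| lra].
        apply least. intros y (Y & fy). apply Rnot_lt_le. intros yx.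
        assert (y <= x) by (apply ub; easy).
        assert (P := He y ltac:(rewrite Rabs_left1; lra)). nra. }
    exists x. split; [split |split]; trivial.
    + destruct x0 as [| <-]; lra.
    + destruct xb as [| ->]; lra.
    + intros y Y. apply Rnot_le_lt. intros fy.
      assert (y <= x) by (apply ub; split; lra). lra.
Qed.

Lemma monotone_limits (f : R -> R) (A B : R) :
  (forall s t, s <= t -> f s <= f t) -> (forall t, A <= f t <= B) ->
  exists l : R, is_lim f p_infty l /\ (forall t, f t <= l) /\ l <= B.
Proof.
  intros inc bd.
  destruct (completeness (fun x => exists t, x = f t)) as (l & ub & least).
  - exists B. intros x (t & ->). apply bd.
  - exists (f 0). now exists 0.
  - exists l. assert (U : forall t, f t <= l) by (intros t; apply ub; now exists t).
    split; [| split]; trivial.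
    + apply is_lim_spec. intros eps.
      destruct (Classical_Prop.classic (exists t, l - eps < f t)) as [(t & T) | no].
      * exists t. intros y ty. generalize (inc t y (Rlt_le _ _ ty)), (U y).
        intros. apply Rabs_def1; lra.
      * exfalso. assert (l <= l - eps).
        { apply least. intros x (t & ->). apply Rnot_lt_le. intros ?. apply no. now exists t. }
        generalize (cond_pos eps). lra.
    + apply least. intros x (t & ->). apply bd.
Qed.

Lemma is_lim_delay (f : R -> R) (d : R) (l : R) :
  is_lim f p_infty l -> is_lim (fun t => f (t - d)) p_infty l.
Proof.
  intros L. apply is_lim_spec. apply is_lim_spec in L. intros e.
  destruct (L e) as (T & HT). exists (T + d). intros y yT. apply HT. lra.
Qed.

Lemma is_lim_scale (f : R -> R) (x : Rbar) (A l : R) :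
  is_lim f x l -> is_lim (fun t => A * f t) x (A * l).
Proof. intros L. exact (is_lim_scal_l f A x l L). Qed.

(** Over unit intervals the increments of [y] tend to [0], and by the mean value
    theorem they are values of [dy] at points that tend to infinity. *)
Lemma derive_limit_zero (y dy : R -> R) (l L : R) :
  (forall t, is_derive y t (dy t)) ->
  is_lim y p_infty l -> is_lim dy p_infty L -> L = 0.
Proof.
  intros D Y DY.
  apply cond_eq. intros e e0. rewrite Rminus_0_r.
  assert (e4 : 0 < e / 4) by lra.
  apply is_lim_spec in Y. apply is_lim_spec in DY.
  destruct (Y (mkposreal _ e4)) as (T1 & H1).
  destruct (DY (mkposreal _ e4)) as (T2 & H2). simpl in H1, H2.
  set (t := Rmax T1 T2 + 1).
  assert (t1 : T1 < t /\ T2 < t).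
  { unfold t. generalize (Rmax_l T1 T2), (Rmax_r T1 T2). lra. }
  destruct (MVT_gen y t (t + 1) dy) as (x & X & E).
  - intros x _; apply D.
  - intros x _. apply continuity_pt_filterlim.
    apply (derive_continuous _ _ _ (D x)).
  - rewrite Rmin_left, Rmax_right in X by lra.
    assert (A1 := H1 t (proj1 t1)). assert (A2 := H1 (t + 1) ltac:(lra)).
    assert (A3 := H2 x ltac:(lra)).
    apply Rabs_def2 in A1. apply Rabs_def2 in A2. apply Rabs_def2 in A3.
    apply Rabs_def1; lra.
Qed.

(** With [e = exp (- (y - x)) >= 1 - (y - x)], the claim reduces to
    [y * (1 - (y - x)) - x = (y - x) * (1 - y) >= 0]. *)
Lemma ricker_monotone (x y : R) :
  0 <= x <= y -> y <= 1 -> x * exp (- x) <= y * exp (- y).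
Proof.
  intros X Y.
  assert (E : exp (- y) = exp (- x) * exp (- (y - x))) by (rewrite <- exp_plus; f_equal; ring).
  rewrite E. generalize (exp_ineq1_le (- (y - x))), (exp_pos (- x)). intros A B.
  assert (x <= y * exp (- (y - x))) by nra. nra.
Qed.

(** * Comparison and bounded solutions for scalar linear equations *)

Lemma is_derive_reflect (f : R -> R) (t l : R) :
  is_derive f (- t) l -> is_derive (fun s => f (- s)) t (- l).
Proof.
  intros D. auto_derive.
  - now exists l.
  - rewrite (is_derive_unique (fun x : R => f x) _ _ D). ring.
Qed.

Lemma is_derive_shift (f : R -> R) (t a l : R) :
  is_derive f (t + a) l -> is_derive (fun s => f (s + a)) t l.
Proof.
  intros D. auto_derive.
  - now exists l.
  - rewrite (is_derive_unique (fun x : R => f x) _ _ D). ring.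
Qed.

Lemma is_derive_diff (f g : R -> R) (t l k : R) :
  is_derive f t l -> is_derive g t k -> is_derive (fun s => f s - g s) t (l - k).
Proof. intros D E. exact (is_derive_minus f g t l k D E). Qed.

(** No sign is imposed on [p]: the lemma serves stable and unstable equations. *)
Lemma gronwall (p : R) (d q : R -> R) :
  (forall t, is_derive d t (p * d t + q t)) -> (forall t, 0 <= q t) ->
  forall s t, s <= t -> exp (p * (t - s)) * d s <= d t.
Proof.
  intros D Q s t st.
  assert (N : exp (- (p * s)) * d s <= exp (- (p * t)) * d t).
  { apply (nondecreasing_of_derive (fun x => exp (- (p * x)) * d x)
             (fun x => exp (- (p * x)) * q x)) with (3 := st).
    - intros x. auto_derive.
      + exact (ex_intro _ _ (D x)).
      + rewrite (is_derive_unique (fun x : R => d x) _ _ (D x)). ring.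
    - intros x. apply Rmult_le_pos; [left; apply exp_pos | apply Q]. }
  apply (Rmult_le_compat_l (exp (p * t))) in N; [| left; apply exp_pos].
  rewrite <- !Rmult_assoc, <- !exp_plus in N.
  replace (p * t + - (p * t)) with 0 in N by ring.
  rewrite exp_0 in N.
  replace (p * t + - (p * s)) with (p * (t - s)) in N by ring. lra.
Qed.

(** For [d' = p * d - q] a negative value of [d] forces [d] to go to minus infinity
    at least like [- exp (p * t)], which a lower bound of smaller exponential
    growth excludes.  The bound is one-sided and exponential because [d] will be
    the difference of a bounded solution and an unbounded exponential barrier. *)
Lemma comparison_unstable (p nu B : R) (d q : R -> R) :
  nu < p ->
  (forall t, is_derive d t (p * d t - q t)) -> (forall t, 0 <= q t) ->
  (forall t, 0 <= t -> - B * exp (nu * t) <= d t) ->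
  forall t, 0 <= d t.
Proof.
  intros np D Q G s.
  destruct (Rle_or_lt 0 (d s)) as [|neg]; [easy | exfalso].
  set (eta := - d s * exp (- (p * s))).
  assert (eta_pos : 0 < eta).
  { apply Rmult_lt_0_compat; [lra | apply exp_pos]. }
  set (t := Rmax (Rmax s 0) (B / eta / (p - nu))).
  assert (ts : s <= t /\ 0 <= t).
  { unfold t. generalize (Rmax_l (Rmax s 0) (B / eta / (p - nu))), (Rmax_l s 0), (Rmax_r s 0). lra. }
  assert (tB : B / eta <= (p - nu) * t).
  { replace (B / eta) with ((p - nu) * (B / eta / (p - nu))) by (field; lra).
    apply Rmult_le_compat_l; [lra | apply Rmax_r]. }
  assert (up : exp (p * (t - s)) * - d s <= - d t).
  { apply (gronwall p (fun x => - d x) q); trivial; [| apply ts].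
    intros x. auto_derive; [exact (ex_intro _ _ (D x)) |].
    rewrite (is_derive_unique (fun x : R => d x) _ _ (D x)). ring. }
  assert (low := G t (proj2 ts)).
  assert (E : exp (p * (t - s)) = exp (- (p * s)) * (exp (nu * t) * exp ((p - nu) * t)))
    by (rewrite <- !exp_plus; f_equal; ring).
  assert (X : eta * exp ((p - nu) * t) <= B).
  { apply Rmult_le_reg_l with (exp (nu * t)); [apply exp_pos |].
    unfold eta. rewrite E in up. nra. }
  generalize (exp_ineq1_le ((p - nu) * t)); intros Y.
  assert (B / eta * eta = B) by (field; lra). nra.
Qed.

(** The time reversal of [comparison_unstable]. *)
Lemma comparison_stable (m B : R) (d q : R -> R) :
  0 < m ->
  (forall t, is_derive d t (- m * d t + q t)) -> (forall t, 0 <= q t) ->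
  (forall t, t <= 0 -> - B <= d t) ->
  forall t, 0 <= d t.
Proof.
  intros m0 D Q G t.
  rewrite <- (Ropp_involutive t).
  apply (comparison_unstable m 0 B (fun x => d (- x)) (fun x => q (- x))); trivial.
  - intros x. replace (m * d (- x) - q (- x)) with (- (- m * d (- x) + q (- x))) by ring.
    now apply is_derive_reflect.
  - intros x x0. rewrite Rmult_0_l, exp_0, Rmult_1_r. apply G. lra.
Qed.

(** The solution is the integral of [exp (- p * (s - t)) * q s] over [s >= t].
    The improper integral is replaced by the supremum of the nondecreasing
    function [F t], the integral of [exp (- p * s) * q s] from [0] to [t]. *)
Lemma bounded_solution_unstable (p B : R) (q : R -> R) :
  0 < p -> (forall t, continuous q t) -> (forall t, 0 <= q t <= p * B) ->
  exists y, (forall t, is_derive y t (p * y t - q t)) /\ (forall t, 0 <= y t <= B).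
Proof.
  intros p0 C Q.
  set (e := fun s => exp (- (p * s)) * q s).
  assert (Ce : forall s, continuous e s).
  { intros s. apply (continuous_mult (fun s => exp (- (p * s)))); [| apply C].
    apply (derive_continuous _ _ (- p * exp (- (p * s)))). auto_derive; [easy | ring]. }
  set (F := fun t => RInt e 0 t).
  assert (DF : forall t, is_derive F t (e t)).
  { intros t. apply (is_derive_RInt e F 0 t); [| apply Ce].
    apply filter_forall. intros x. apply (RInt_correct e).
    apply (ex_RInt_continuous e). intros; apply Ce. }
  assert (incF : forall s t, s <= t -> F s <= F t).
  { apply (nondecreasing_of_derive F e DF). intros t.
    apply Rmult_le_pos; [left; apply exp_pos | apply Q]. }
  assert (bdF : forall s t, F s <= F t + B * exp (- (p * t))).
  { assert (dec : forall s t, s <= t ->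
      - F s - B * exp (- (p * s)) <= - F t - B * exp (- (p * t))).
    { apply (nondecreasing_of_derive (fun t => - F t - B * exp (- (p * t)))
        (fun t => exp (- (p * t)) * (p * B - q t))).
      - intros t. auto_derive; [now exists (e t) |].
        rewrite (is_derive_unique (fun x : R => F x) _ _ (DF t)). unfold e. ring.
      - intros t. apply Rmult_le_pos; [left; apply exp_pos | generalize (Q t); lra]. }
    assert (B0 : forall t, 0 <= B * exp (- (p * t))).
    { intros t. apply Rmult_le_pos; [| left; apply exp_pos].
      generalize (Q t); intros. nra. }
    intros s t. destruct (Rle_or_lt s t) as [st | ts].
    - generalize (incF s t st), (B0 t). lra.
    - generalize (dec t s (Rlt_le _ _ ts)), (B0 s). lra. }
  destruct (completeness (fun x => exists t, x = F t)) as (S & ub & least).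
  - exists (F 0 + B * exp (- (p * 0))). intros x (t & ->). apply bdF.
  - exists (F 0). now exists 0.
  - exists (fun t => exp (p * t) * (S - F t)). split; intros t.
    + auto_derive; [now exists (e t) |].
      rewrite (is_derive_unique (fun x : R => F x) _ _ (DF t)). unfold e.
      assert (E : exp (p * t) * exp (- (p * t)) = 1)
        by (rewrite <- exp_plus, Rplus_opp_r; apply exp_0).
      transitivity (p * (exp (p * t) * (S - F t)) - exp (p * t) * exp (- (p * t)) * q t); [ring |].
      rewrite E. ring.
    + assert (L : F t <= S) by (apply ub; now exists t).
      assert (U : S <= F t + B * exp (- (p * t))).
      { apply least. intros x (s & ->). apply bdF. }
      assert (E : exp (p * t) * exp (- (p * t)) = 1)
        by (rewrite <- exp_plus, Rplus_opp_r; apply exp_0).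
      generalize (exp_pos (p * t)). intros P. split; [apply Rmult_le_pos; lra |].
      apply Rle_trans with (exp (p * t) * (B * exp (- (p * t)))).
      * apply Rmult_le_compat_l; lra.
      * right. transitivity (B * (exp (p * t) * exp (- (p * t)))); [ring |]. rewrite E. ring.
Qed.

(** The time reversal of [bounded_solution_unstable]. *)
Lemma bounded_solution_stable (m B : R) (q : R -> R) :
  0 < m -> (forall t, continuous q t) -> (forall t, 0 <= q t <= m * B) ->
  exists y, (forall t, is_derive y t (- m * y t + q t)) /\ (forall t, 0 <= y t <= B).
Proof.
  intros m0 C Q.
  destruct (bounded_solution_unstable m B (fun t => q (- t))) as (y & D & Y); trivial.
  - intros t. apply (continuous_comp Ropp q); [| apply C].
    apply (continuous_opp (fun x : R => x)). apply continuous_id.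
  - exists (fun t => y (- t)). split; intros t; [| apply Y].
    replace (- m * y (- t) + q t) with (- (m * y (- t) - q (- - t)))
      by (rewrite Ropp_involutive; ring).
    now apply is_derive_reflect.
Qed.

(** * Fixed points of monotone relations between functions *)

(** The Knaster-Tarski argument: the infimum of the [w] whose image lies below [w]
    is a fixed point.  The map is given as a relation [T], so that no choice of
    the bounded solutions that define it is needed.  The equality of [w] and [v]
    is pointwise, which avoids functional extensionality. *)
Lemma fixed_point_of_monotone_relation
    (X : (R -> R) -> Prop) (T : (R -> R) -> (R -> R) -> Prop) (top : R -> R) :
  (forall w, X w -> exists v, T w v /\ X v) ->
  (forall w1 w2 v1 v2, X w1 -> X w2 -> T w1 v1 -> T w2 v2 ->
     (forall t, w1 t <= w2 t) -> forall t, v1 t <= v2 t) ->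
  (forall A : (R -> R) -> Prop, (forall w, A w -> X w) -> (exists w, A w) ->
     exists f, X f /\ (forall w, A w -> forall t, f t <= w t) /\
       (forall t x, (forall w, A w -> x <= w t) -> x <= f t)) ->
  X top -> (forall w, X w -> forall t, w t <= top t) ->
  exists w v, X w /\ T w v /\ forall t, v t = w t.
Proof.
  intros ex mono inf Xtop le_top.
  set (A := fun w => X w /\ exists v, T w v /\ X v /\ forall t, v t <= w t).
  destruct (inf A) as (w & Xw & low & great).
  - now intros w (Xw & _).
  - exists top. split; [easy |]. destruct (ex top Xtop) as (v & Tv & Xv).
    exists v. split; [easy | split; [easy |]]. now apply le_top.
  - destruct (ex w Xw) as (v & Tv & Xv).
    assert (vw : forall t, v t <= w t).
    { intros t. apply great. intros w' Aw'. assert (L := low w' Aw').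
      destruct Aw' as (Xw' & v' & Tv' & _ & vw').
      apply Rle_trans with (v' t); [| apply vw'].
      now apply (mono w w' v v'). }
    exists w, v. split; [easy | split; [easy |]]. intros t.
    apply Rle_antisym; [apply vw |]. apply low. split; [easy |].
    destruct (ex v Xv) as (v' & Tv' & Xv'). exists v'. split; [easy | split; [easy |]].
    now apply (mono v w v' v).
Qed.

(** Monotonicity together with a one-sided Lipschitz bound: each half passes to
    pointwise infima, and together they give continuity. *)
Definition slope_between_0_and (L : R) (w : R -> R) : Prop :=
  forall s t, s <= t -> w s <= w t <= w s + L * (t - s).

Definition in_band (L : R) (lo hi w : R -> R) : Prop :=
  slope_between_0_and L w /\ forall t, lo t <= w t <= hi t.

Lemma in_band_infimum (L : R) (lo hi : R -> R) (A : (R -> R) -> Prop) :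
  (forall w, A w -> in_band L lo hi w) -> (exists w, A w) ->
  exists f, in_band L lo hi f /\ (forall w, A w -> forall t, f t <= w t) /\
    (forall t x, (forall w, A w -> x <= w t) -> x <= f t).
Proof.
  intros AX (w0 & A0).
  set (val := fun t x => exists w, A w /\ x = - w t).
  assert (S : forall t, { l : R | is_lub (val t) l }).
  { intros t. apply completeness.
    - exists (- lo t). intros x (w & Aw & ->). generalize (proj2 (AX w Aw) t). lra.
    - exists (- w0 t). now exists w0. }
  set (f := fun t => - proj1_sig (S t)).
  assert (low : forall w, A w -> forall t, f t <= w t).
  { intros w Aw t. unfold f. destruct (S t) as (l & ub & least). simpl.
    assert (- w t <= l) by (apply ub; now exists w). lra. }
  assert (great : forall t x, (forall w, A w -> x <= w t) -> x <= f t).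
  { intros t x Hx. unfold f. destruct (S t) as (l & ub & least). simpl.
    assert (l <= - x); [| lra]. apply least. intros y (w & Aw & ->).
    generalize (Hx w Aw). lra. }
  exists f. split; [split | split]; trivial.
  - intros s t st. split.
    + apply great. intros w Aw. apply Rle_trans with (w s); [now apply low |].
      now apply (proj1 (AX w Aw)).
    + assert (f t - L * (t - s) <= f s); [| lra].
      apply great. intros w Aw.
      generalize (low w Aw t), (proj1 (AX w Aw) s t st). lra.
  - intros t. split.
    + apply great. intros w Aw. apply (proj2 (AX w Aw)).
    + apply Rle_trans with (w0 t); [now apply low |]. apply (proj2 (AX w0 A0)).
Qed.

Lemma slope_bound_continuous (L : R) (w : R -> R) :
  slope_between_0_and L w -> forall t, continuous w t.
Proof.
  intros S t. apply continuity_pt_filterlim.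
  intros e e0. exists (e / (Rabs L + 1)).
  assert (L0 : 0 < Rabs L + 1) by (generalize (Rabs_pos L); lra).
  split; [now apply Rdiv_lt_0_compat |].
  intros x (_ & X). simpl in *. unfold R_dist in *.
  assert (Y : Rabs (x - t) * (Rabs L + 1) < e).
  { apply Rlt_div_r; [lra | exact X]. }
  assert (B := Rle_abs L).
  destruct (Rle_or_lt t x) as [tx | xt].
  - destruct (S t x tx). rewrite Rabs_pos_eq in Y |- * by lra.
    apply Rle_lt_trans with (2 := Y). nra.
  - destruct (S x t (Rlt_le _ _ xt)). rewrite Rabs_left1 in Y |- * by lra.
    apply Rle_lt_trans with (2 := Y). nra.
Qed.

(** * The factored profile equation *)

Section Factored_profile_equation.

(** The delays of the profile equation are [a = c * sigma] and [b = c * r]; [k] is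
    the positive equilibrium, and [- m] is the negative root of the
    characteristic function of the linear part. *)
Variables delta rho H c a b k m : R.
Hypotheses (delta_pos : 0 < delta) (rho_pos : 0 < rho) (H_pos : 0 < H) (c_pos : 0 < c)
  (a_nonneg : 0 <= a) (b_nonneg : 0 <= b) (k_range : 0 < k <= 1)
  (k_equilibrium : rho * exp (- k) = delta + H)
  (m_pos : 0 < m) (m_root : m ^ 2 + c * m = delta + H * exp (m * a)).

(** What remains of the profile equation, with opposite sign, once its linear part
    has been divided by the factor [d/ds + m].  The coefficient [exp (m * a)]
    compensates the decay of [exp (- m * t)] over the delay [a]; see [exp_gap]. *)
Definition feedback (u : R -> R) (t : R) : R :=
  rho * (u (t - b) * exp (- u (t - b))) + H * (exp (m * a) * u t - u (t - a)).

(** The function [exp (m * t) * d t] is nondecreasing.  This is how the delayed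
    negative term of [feedback] is absorbed. *)
Lemma exp_gap (d q : R -> R) :
  (forall t, is_derive d t (- m * d t + q t)) -> (forall t, 0 <= q t) ->
  forall t, d (t - a) <= exp (m * a) * d t.
Proof.
  intros D Q t.
  assert (G := gronwall (- m) d q D Q (t - a) t ltac:(lra)).
  replace (- m * (t - (t - a))) with (- (m * a)) in G by ring.
  apply (Rmult_le_compat_l (exp (m * a))) in G; [| left; apply exp_pos].
  rewrite <- Rmult_assoc, <- exp_plus, Rplus_opp_r, exp_0 in G. lra.
Qed.

Lemma feedback_monotone (u1 u2 : R -> R) :
  (forall t, 0 <= u1 t <= u2 t) -> (forall t, u2 t <= 1) ->
  (forall t, u2 (t - a) - u1 (t - a) <= exp (m * a) * (u2 t - u1 t)) ->
  forall t, feedback u1 t <= feedback u2 t.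
Proof.
  intros U B G t. unfold feedback.
  generalize (ricker_monotone (u1 (t - b)) (u2 (t - b)) (U _) (B _)), (G t).
  intros. nra.
Qed.

(** The upper bound is the value of [feedback] at the constant [k], at which the
    system with [w = m * k] is in equilibrium. *)
Lemma feedback_range (w u : R -> R) :
  (forall t, is_derive u t (- m * u t + w t)) -> (forall t, 0 <= w t <= m * k) ->
  (forall t, 0 <= u t <= k) ->
  forall t, 0 <= feedback u t <= (c + m) * (m * k).
Proof.
  intros D W U t. split.
  - unfold feedback.
    assert (G := exp_gap u w D (fun t => proj1 (W t)) t).
    assert (0 <= rho * (u (t - b) * exp (- u (t - b)))); [| nra].
    apply Rmult_le_pos; [lra |]. apply Rmult_le_pos; [apply U | left; apply exp_pos].
  - replace ((c + m) * (m * k)) with (feedback (fun _ => k) t).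
    + apply feedback_monotone; intros s; [apply U | apply k_range |].
      apply (exp_gap (fun s => k - u s) (fun s => m * k - w s)); intros x.
      * auto_derive; [exact (ex_intro _ _ (D x)) |].
        rewrite (is_derive_unique (fun x : R => u x) _ _ (D x)). ring.
      * generalize (W x). lra.
    + unfold feedback.
      transitivity (k * (rho * exp (- k) + (H * exp (m * a) - H))); [ring |].
      rewrite k_equilibrium.
      replace (H * exp (m * a)) with (m ^ 2 + c * m - delta) by lra. ring.
Qed.

(** The relation between [w] and its image [v], with the intermediate profile [u].
    The bounds select the bounded solutions of the two equations.  When [v = w],
    the function [u] solves the profile equation. *)
Definition stage (w u v : R -> R) : Prop :=
  (forall t, is_derive u t (- m * u t + w t)) /\
  (forall t, 0 <= u t <= k) /\
  (forall t, is_derive v t ((c + m) * v t - feedback u t)) /\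
  (forall t, 0 <= v t <= m * k).

Lemma feedback_continuous (u : R -> R) :
  (forall t, ex_derive u t) -> forall t, continuous (feedback u) t.
Proof.
  intros D t. apply (ex_derive_continuous (V := R_NormedModule)).
  unfold feedback. auto_derive. repeat split; trivial.
Qed.

Lemma stage_exists (w : R -> R) :
  (forall t, continuous w t) -> (forall t, 0 <= w t <= m * k) ->
  exists u v, stage w u v.
Proof.
  intros C W.
  destruct (bounded_solution_stable m k w m_pos C W) as (u & D & U).
  destruct (bounded_solution_unstable (c + m) (m * k) (feedback u)) as (v & E & V).
  - lra.
  - apply feedback_continuous. intros t. eexists; apply D.
  - now apply (feedback_range w).
  - now exists u, v.
Qed.

Lemma stage_monotone (w1 u1 v1 w2 u2 v2 : R -> R) :
  stage w1 u1 v1 -> stage w2 u2 v2 -> (forall t, w1 t <= w2 t) ->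
  (forall t, u1 t <= u2 t) /\ (forall t, v1 t <= v2 t).
Proof.
  intros (D1 & U1 & E1 & V1) (D2 & U2 & E2 & V2) W.
  assert (D : forall t, is_derive (fun t => u2 t - u1 t) t
                (- m * (u2 t - u1 t) + (w2 t - w1 t))).
  { intros t. replace (- m * (u2 t - u1 t) + (w2 t - w1 t))
      with ((- m * u2 t + w2 t) - (- m * u1 t + w1 t)) by ring.
    apply is_derive_diff; [apply D2 | apply D1]. }
  assert (Q : forall t, 0 <= w2 t - w1 t) by (intros t; generalize (W t); lra).
  assert (U : forall t, u1 t <= u2 t).
  { intros t. apply Rge_le, Rminus_ge, Rle_ge.
    apply (comparison_stable m k (fun t => u2 t - u1 t) (fun t => w2 t - w1 t)); trivial.
    intros s _. generalize (U1 s), (U2 s). lra. }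
  split; [exact U |]. intros t. apply Rge_le, Rminus_ge, Rle_ge.
  apply (comparison_unstable (c + m) 0 (m * k) (fun t => v2 t - v1 t)
           (fun t => feedback u2 t - feedback u1 t)); [lra | | |].
  - intros s. replace ((c + m) * (v2 s - v1 s) - (feedback u2 s - feedback u1 s))
      with (((c + m) * v2 s - feedback u2 s) - ((c + m) * v1 s - feedback u1 s)) by ring.
    apply is_derive_diff; [apply E2 | apply E1].
  - intros s. apply Rge_le, Rge_minus, Rle_ge. apply feedback_monotone.
    + intros x. split; [apply U1 | apply U].
    + intros x. generalize (U2 x). lra.
    + apply (exp_gap (fun t => u2 t - u1 t) (fun t => w2 t - w1 t)); trivial.
  - intros s _. rewrite Rmult_0_l, exp_0. generalize (V1 s), (V2 s). lra.
Qed.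

Lemma stage_shift (h : R) (w u v : R -> R) :
  stage w u v ->
  stage (fun t => w (t + h)) (fun t => u (t + h)) (fun t => v (t + h)).
Proof.
  intros (D & U & E & V). split; [| split; [| split]]; intros t.
  - apply is_derive_shift, D.
  - apply U.
  - replace (feedback (fun t0 => u (t0 + h)) t) with (feedback u (t + h)).
    + apply (is_derive_shift v), E.
    + unfold feedback.
      replace (t + h - b) with (t - b + h) by ring.
      now replace (t + h - a) with (t - a + h) by ring.
  - apply V.
Qed.

(** The equations are autonomous, so this is monotonicity of the map applied to [w]
    and a translate of [w] to the left. *)
Lemma stage_nondecreasing (w u v : R -> R) :
  stage w u v -> (forall s t, s <= t -> w s <= w t) ->
  (forall s t, s <= t -> u s <= u t) /\ (forall s t, s <= t -> v s <= v t).
Proof.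
  intros S W.
  assert (K : forall s t, s <= t -> u s <= u t /\ v s <= v t).
  { intros s t st.
    destruct (stage_monotone w u v _ _ _ S (stage_shift (t - s) w u v S)) as (U & V).
    - intros x. apply W. lra.
    - replace t with (s + (t - s)) by ring. easy. }
  split; intros; now apply K.
Qed.

Lemma stage_slope (w u v : R -> R) :
  stage w u v -> (forall t, 0 <= w t <= m * k) -> (forall s t, s <= t -> w s <= w t) ->
  slope_between_0_and ((c + m) * (m * k)) v.
Proof.
  intros S W inc s t st. split; [now apply (stage_nondecreasing w u v S inc) |].
  destruct S as (D & U & E & V).
  enough ((c + m) * (m * k) * s - v s <= (c + m) * (m * k) * t - v t) by lra.
  apply (nondecreasing_of_derive (fun x => (c + m) * (m * k) * x - v x)
    (fun x => (c + m) * (m * k) - ((c + m) * v x - feedback u x))); trivial.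
  - intros x. apply (is_derive_diff (fun x => (c + m) * (m * k) * x)); [| apply E].
    auto_derive; [easy | ring].
  - intros x. generalize (feedback_range w u D W U x), (V x). intros. nra.
Qed.

(** * Exponential barriers *)

(** Up to sign, the characteristic function of the profile equation linearised
    at [0]. *)
Definition characteristic (z : R) : R :=
  c * z - z ^ 2 + delta + H * exp (- (z * a)) - rho * exp (- (z * b)).

(** The barrier [(lam + m) * exp (lam * t)] is a fixed point of the linearised map,
    with profile [exp (lam * t)], and the nonlinear map lies below the linearised
    one as [x * exp (- x) <= x]. *)
Lemma stage_upper (lam : R) (w u v : R -> R) :
  0 < lam < c + m -> characteristic lam = 0 -> stage w u v ->
  (forall t, w t <= (lam + m) * exp (lam * t)) ->
  (forall t, u t <= exp (lam * t)) /\ (forall t, v t <= (lam + m) * exp (lam * t)).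
Proof.
  intros lam_range root (D & U & E & V) W.
  assert (D' : forall t, is_derive (fun t => exp (lam * t) - u t) t
             (- m * (exp (lam * t) - u t) + ((lam + m) * exp (lam * t) - w t))).
  { intros t. auto_derive; [exact (ex_intro _ _ (D t)) |].
    rewrite (is_derive_unique (fun x : R => u x) _ _ (D t)). ring. }
  assert (Q : forall t, 0 <= (lam + m) * exp (lam * t) - w t)
    by (intros t; generalize (W t); lra).
  assert (UE : forall t, u t <= exp (lam * t)).
  { intros t. apply Rge_le, Rminus_ge, Rle_ge.
    apply (comparison_stable m k _ _ m_pos D' Q).
    intros s _. generalize (U s), (exp_pos (lam * s)). lra. }
  split; [exact UE |]. intros t. apply Rge_le, Rminus_ge, Rle_ge.
  apply (comparison_unstable (c + m) 0 (m * k) (fun t => (lam + m) * exp (lam * t) - v t)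
           (fun t => (c + m - lam) * ((lam + m) * exp (lam * t)) - feedback u t)); [lra | | |].
  - intros s. auto_derive; [exact (ex_intro _ _ (E s)) |].
    rewrite (is_derive_unique (fun x : R => v x) _ _ (E s)). ring.
  - intros s. unfold feedback.
    assert (G := exp_gap _ _ D' Q s). cbv beta in G.
    assert (F : u (s - b) * exp (- u (s - b)) <= exp (lam * (s - b))).
    { apply Rle_trans with (2 := UE (s - b)).
      assert (exp (- u (s - b)) <= 1).
      { rewrite <- exp_0. apply exp_nondecreasing.
        generalize (U (s - b)). lra. }
      generalize (U (s - b)). intros. nra. }
    rewrite delayed_exp in F, G. unfold characteristic in root.
    set (e := exp (lam * s)) in *.
    assert (I : (c + m - lam) * ((lam + m) * e)
      = e * (rho * exp (- (lam * b)) + (H * exp (m * a) - H * exp (- (lam * a))))).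
    { replace (H * exp (m * a)) with (m ^ 2 + c * m - delta) by lra.
      replace (rho * exp (- (lam * b)))
        with (c * lam - lam ^ 2 + delta + H * exp (- (lam * a))) by lra. ring. }
    rewrite I. nra.
  - intros s _. rewrite Rmult_0_l, exp_0.
    generalize (V s), (exp_pos (lam * s)). intros. nra.
Qed.

(** The nonlinearity differs from its linearisation by at most [rho * u ^ 2], and
    [u ^ 2 <= exp (mu * t)] on the whole line: for [t <= 0] because
    [u <= exp (lam * t)] and [mu <= 2 * lam], for [t > 0] because [u <= k <= 1].
    The gain [M * characteristic mu * exp (mu * t)] of the corrective exponential
    pays for this error.  The barrier becomes negative for large [t], and it need
    not be truncated there because only the linear bound [u >= barrier] enters. *)
Lemma stage_lower (lam mu M : R) (w u v : R -> R) :
  0 < lam < mu -> mu <= 2 * lam -> mu < c + m -> 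
  characteristic lam = 0 -> 0 <= M -> rho <= M * characteristic mu ->
  stage w u v -> (forall t, u t <= exp (lam * t)) ->
  (forall t, (lam + m) * exp (lam * t) - M * ((mu + m) * exp (mu * t)) <= w t) ->
  (forall t, exp (lam * t) - M * exp (mu * t) <= u t) /\
  (forall t, (lam + m) * exp (lam * t) - M * ((mu + m) * exp (mu * t)) <= v t).
Proof.
  intros lam_mu mu_le mu_lt root M0 HM (D & U & E & V) UE W.
  assert (D' : forall t, is_derive (fun t => u t - (exp (lam * t) - M * exp (mu * t))) t
      (- m * (u t - (exp (lam * t) - M * exp (mu * t)))
       + (w t - ((lam + m) * exp (lam * t) - M * ((mu + m) * exp (mu * t)))))).
  { intros t. auto_derive; [exact (ex_intro _ _ (D t)) |].
    rewrite (is_derive_unique (fun x : R => u x) _ _ (D t)). ring. }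
  assert (Q : forall t, 0 <= w t - ((lam + m) * exp (lam * t) - M * ((mu + m) * exp (mu * t))))
    by (intros t; generalize (W t); lra).
  assert (UL : forall t, exp (lam * t) - M * exp (mu * t) <= u t).
  { intros t. apply Rge_le, Rminus_ge, Rle_ge.
    apply (comparison_stable m 1 _ _ m_pos D' Q).
    intros s s0. assert (exp (lam * s) <= 1).
    { rewrite <- exp_0. apply exp_nondecreasing. nra. }
    generalize (U s), (exp_pos (mu * s)). intros. nra. }
  split; [exact UL |]. intros t. apply Rge_le, Rminus_ge, Rle_ge.
  apply (comparison_unstable (c + m) lam (lam + m)
           (fun t => v t - ((lam + m) * exp (lam * t) - M * ((mu + m) * exp (mu * t))))
           (fun t => feedback u t - ((c + m - lam) * ((lam + m) * exp (lam * t))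
                     - M * ((c + m - mu) * ((mu + m) * exp (mu * t)))))); [lra | | |].
  - intros s. auto_derive; [exact (ex_intro _ _ (E s)) |].
    rewrite (is_derive_unique (fun x : R => v x) _ _ (E s)). ring.
  - intros s. unfold feedback.
    assert (G := exp_gap _ _ D' Q s). cbv beta in G.
    assert (L := UL (s - b)).
    assert (F : u (s - b) - exp (mu * (s - b)) <= u (s - b) * exp (- u (s - b))).
    { assert (S : u (s - b) * u (s - b) <= exp (mu * (s - b))).
      { assert (X := U (s - b)). assert (Y := UE (s - b)).
        destruct (Rle_or_lt (s - b) 0) as [neg | pos].
        - apply Rle_trans with (exp (lam * (s - b)) * exp (lam * (s - b))); [nra |].
          rewrite <- exp_plus. apply exp_nondecreasing. nra.
        - apply Rle_trans with 1; [nra |]. rewrite <- exp_0. apply exp_nondecreasing. nra. }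
      generalize (exp_ineq1_le (- u (s - b))), (U (s - b)). intros. nra. }
    rewrite delayed_exp in F. rewrite !(delayed_exp lam), !(delayed_exp mu) in G, L. unfold characteristic in root, HM.
    set (e := exp (lam * s)) in *. set (E' := exp (mu * s)) in *.
    assert (E0 : 0 < E') by apply exp_pos.
    assert (I : (c + m - lam) * ((lam + m) * e)
      = e * (rho * exp (- (lam * b)) + (H * exp (m * a) - H * exp (- (lam * a))))).
    { replace (H * exp (m * a)) with (m ^ 2 + c * m - delta) by lra.
      replace (rho * exp (- (lam * b)))
        with (c * lam - lam ^ 2 + delta + H * exp (- (lam * a))) by lra. ring. }
    assert (B1 : exp (- (mu * b)) <= 1).
    { rewrite <- exp_0. apply exp_nondecreasing. nra. }
    assert (J : rho * (E' * exp (- (mu * b))) <= M * ((c + m - mu) * ((mu + m) * E'))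
      - M * (E' * (rho * exp (- (mu * b)) + (H * exp (m * a) - H * exp (- (mu * a)))))).
    { replace (H * exp (m * a)) with (m ^ 2 + c * m - delta) by lra.
      assert (rho * (E' * exp (- (mu * b))) <= rho * (E' * 1))
        by (do 2 (apply Rmult_le_compat_l; [lra |]); exact B1).
      apply (Rmult_le_compat_l E') in HM; lra. }
    apply (Rmult_le_compat_l rho) in F, L; try lra.
    apply (Rmult_le_compat_l H) in G; [| lra]. rewrite I. lra.
  - intros s _. generalize (V s), (exp_pos (lam * s)), (exp_pos (mu * s)). intros.
    assert (0 <= M * ((mu + m) * exp (mu * s))) by (apply Rmult_le_pos; nra). nra.
Qed.

(** * Existence of the wave *)

(** The limits [l] of [u] and [n] of [w] satisfy both equations with vanishing
    derivatives; eliminating [n] with the equation for [m] leaves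
    [rho * exp (- l) = delta + H]. *)
Lemma stage_limit (w u : R -> R) (t0 : R) :
  stage w u w -> (forall s t, s <= t -> w s <= w t) -> 0 < u t0 ->
  is_lim u p_infty k.
Proof.
  intros S incw ut0.
  assert (incu : forall s t, s <= t -> u s <= u t) by apply (stage_nondecreasing w u w S incw).
  destruct S as (D & U & E & W).
  destruct (monotone_limits u 0 k incu U) as (l & Lu & ul & lk).
  destruct (monotone_limits w 0 (m * k) incw W) as (n & Lw & _ & _).
  assert (l0 : 0 < l) by (generalize (ul t0); lra).
  assert (Z1 : - m * l + n = 0).
  { apply (derive_limit_zero u _ l _ D Lu).
    apply is_lim_plus'; [| exact Lw]. now apply is_lim_scale. }
  assert (Lf : is_lim (feedback u) p_infty
                 (rho * (l * exp (- l)) + H * (exp (m * a) * l - l))).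
  { unfold feedback. apply is_lim_plus'.
    - apply is_lim_scale. apply (is_lim_delay (fun t => u t * exp (- u t))).
      apply (is_lim_comp_continuous u (fun x => x * exp (- x))); [exact Lu |].
      apply (ex_derive_continuous (V := R_NormedModule)). now auto_derive.
    - apply is_lim_scale. apply is_lim_minus'.
      + now apply is_lim_scale.
      + now apply is_lim_delay. }
  assert (Z2 : (c + m) * n - (rho * (l * exp (- l)) + H * (exp (m * a) * l - l)) = 0).
  { apply (derive_limit_zero w _ n _ E Lw).
    apply is_lim_minus'; [| exact Lf]. now apply is_lim_scale. }
  replace k with l; [exact Lu |].
  assert (X : l * (rho * exp (- l)) = l * (rho * exp (- k))).
  { rewrite k_equilibrium. replace n with (m * l) in Z2 by lra.
    transitivity (l * (m ^ 2 + c * m - H * exp (m * a) + H)); [lra |].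
    rewrite m_root. ring. }
  apply Rmult_eq_reg_l in X; [| lra]. apply Rmult_eq_reg_l in X; [| lra].
  apply exp_inv in X. lra.
Qed.

(** The lower bound on [w] keeps the fixed point away from the trivial solution, and
    the upper bound makes the profile vanish at minus infinity.  The assumption
    that the lower barrier stays below [m * k] makes the largest element of the
    band, at which the descent to the fixed point starts, admissible. *)
Lemma exists_factored_wave (lam mu M : R) :
  0 < lam < mu -> mu <= 2 * lam -> mu < c + m ->
  characteristic lam = 0 -> 0 < M -> rho <= M * characteristic mu ->
  (forall t, (lam + m) * exp (lam * t) - M * ((mu + m) * exp (mu * t)) <= m * k) ->
  exists w u, stage w u w /\ is_lim u m_infty 0 /\ is_lim u p_infty k.
Proof.
  intros lam_mu mu_le mu_lt root M0 HM lo_small.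
  set (lo := fun t => Rmax 0 ((lam + m) * exp (lam * t) - M * ((mu + m) * exp (mu * t)))).
  set (hi := fun t => Rmin (m * k) ((lam + m) * exp (lam * t))).
  set (L := (c + m) * (m * k)).
  assert (mk : 0 < m * k) by (apply Rmult_lt_0_compat; lra).
  assert (band : forall w, (forall t, lo t <= w t <= hi t) <->
    (forall t, 0 <= w t <= m * k) /\ (forall t, w t <= (lam + m) * exp (lam * t)) /\
    (forall t, (lam + m) * exp (lam * t) - M * ((mu + m) * exp (mu * t)) <= w t)).
  { intros w. unfold lo, hi. split.
    - intros B. split; [| split]; intros t; destruct (B t) as (B1 & B2);
        generalize (Rmax_l 0 ((lam + m) * exp (lam * t) - M * ((mu + m) * exp (mu * t)))),
          (Rmax_r 0 ((lam + m) * exp (lam * t) - M * ((mu + m) * exp (mu * t)))),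
          (Rmin_l (m * k) ((lam + m) * exp (lam * t))),
          (Rmin_r (m * k) ((lam + m) * exp (lam * t))); lra.
    - intros (B1 & B2 & B3) t. split; [apply Rmax_lub | apply Rmin_glb]; auto; apply B1. }
  destruct (fixed_point_of_monotone_relation (in_band L lo hi)
             (fun w v => exists u, stage w u v) hi) as (w & v & (Sw & Bw) & (u & S) & vw).
  - intros w (Sl & B). apply band in B. destruct B as (B1 & B2 & B3).
    destruct (stage_exists w (slope_bound_continuous L w Sl) B1) as (u & v & S).
    exists v. split; [now exists u |].
    assert (UP := stage_upper lam w u v ltac:(lra) root S B2).
    assert (LO := stage_lower lam mu M w u v lam_mu mu_le mu_lt root (Rlt_le _ _ M0) HM
                    S (proj1 UP) B3).
    split; [apply (stage_slope w u v S B1) |].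
    + intros s t st. apply (Sl s t st).
    + apply band. split; [apply S | split; [apply UP | apply LO]].
  - intros w1 w2 v1 v2 _ _ (u1 & S1) (u2 & S2) W.
    apply (stage_monotone w1 u1 v1 w2 u2 v2 S1 S2 W).
  - apply in_band_infimum.
  - split.
    + intros s t st. unfold hi, L.
      assert (e1 : exp (lam * s) <= exp (lam * t)) by (apply exp_nondecreasing; nra).
      split.
      * apply Rmin_glb; [apply Rmin_l |].
        apply Rle_trans with (1 := Rmin_r _ _). nra.
      (* Over a step of length [t - s] the function [hi] loses at most the factor
         [exp (- lam * (t - s)) >= 1 - lam * (t - s)], and [hi] is at most [m * k]. *)
      * assert (e2 : exp (lam * t) * (1 - lam * (t - s)) <= exp (lam * s)).
        { replace (lam * s) with (lam * t + - (lam * (t - s))) by ring.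
          rewrite exp_plus. apply Rmult_le_compat_l; [left; apply exp_pos |].
          generalize (exp_ineq1_le (- (lam * (t - s)))). lra. }
        set (x := Rmin (m * k) ((lam + m) * exp (lam * t))).
        assert (x1 : x <= m * k) by apply Rmin_l.
        assert (x2 : x <= (lam + m) * exp (lam * t)) by apply Rmin_r.
        assert (slope : lam * (m * k) * (t - s) <= (c + m) * (m * k) * (t - s)).
        { apply Rmult_le_compat_r; [lra |]. apply Rmult_le_compat_r; lra. }
        enough (x - lam * (m * k) * (t - s) <= Rmin (m * k) ((lam + m) * exp (lam * s))) by lra.
        assert (0 <= lam * (t - s)) by (apply Rmult_le_pos; lra).
        apply Rmin_glb; [nra |].
        destruct (Rle_or_lt (lam * (t - s)) 1).
        -- apply Rle_trans with ((lam + m) * (exp (lam * t) * (1 - lam * (t - s)))); [nra |].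
           apply Rmult_le_compat_l; lra.
        -- generalize (exp_pos (lam * s)). intros. nra.
    + apply band. unfold hi. split; [| split]; intros t.
      * split; [| apply Rmin_l]. apply Rmin_glb; [lra |].
        apply Rmult_le_pos; [lra | left; apply exp_pos].
      * apply Rmin_r.
      * apply Rmin_glb; [apply lo_small |].
        assert (0 <= M * ((mu + m) * exp (mu * t))); [| lra].
        apply Rmult_le_pos; [lra |]. apply Rmult_le_pos; [lra | left; apply exp_pos].
  - intros w (_ & B). apply B.
  - apply band in Bw. destruct Bw as (B1 & B2 & B3).
    assert (UP := stage_upper lam w u v ltac:(lra) root S B2).
    assert (LO := stage_lower lam mu M w u v lam_mu mu_le mu_lt root (Rlt_le _ _ M0) HM
                    S (proj1 UP) B3).
    assert (S' : stage w u w).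
    { destruct S as (D & U & E & V). split; [easy | split; [easy | split; [| exact B1]]].
      intros t. apply is_derive_ext with v; [exact vw |]. rewrite <- vw. apply E. }
    exists w, u. split; [exact S' | split].
    + apply is_lim_spec. intros e. exists (ln e / lam). intros y Y.
      assert (Z : exp (lam * y) < e).
      { rewrite <- (exp_ln e) by apply cond_pos. apply exp_increasing.
        apply (Rmult_lt_compat_l lam) in Y; [| lra].
        replace (lam * (ln e / lam)) with (ln e) in Y by (field; lra). exact Y. }
      generalize (proj1 UP y), (proj1 (proj2 S) y). intros.
      rewrite Rminus_0_r, Rabs_pos_eq; lra.
    (* At this point [exp ((mu - lam) * t)] equals [/ (M + 1)], so the lower barrier
       [exp (lam * t) - M * exp (mu * t)] of the profile is positive. *)
    + apply (stage_limit w u (- ln (M + 1) / (mu - lam)) S').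
      * intros s t st. apply (Sw s t st).
      * eapply Rlt_le_trans; [| apply (proj1 LO)].
        set (t := - ln (M + 1) / (mu - lam)).
        replace (mu * t) with (lam * t + - ln (M + 1)) by (unfold t; field; lra).
        rewrite exp_plus, exp_Ropp, exp_ln by lra.
        replace (exp (lam * t) - M * (exp (lam * t) * / (M + 1)))
          with (exp (lam * t) * / (M + 1)) by (field; lra).
        apply Rmult_lt_0_compat; [apply exp_pos | apply Rinv_0_lt_compat; lra].
Qed.

(** Up to the point [t0] where the upper barrier reaches [m * k] the lower barrier is
    below [m * k]; a large [M] makes the lower barrier nonpositive after [t0]. *)
Lemma exists_subsolution_coefficient (lam mu : R) :
  0 < lam < mu ->
  exists M0, 0 < M0 /\ forall M, M0 <= M ->
    forall t, (lam + m) * exp (lam * t) - M * ((mu + m) * exp (mu * t)) <= m * k.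
Proof.
  intros lam_mu.
  assert (mk : 0 < m * k) by (apply Rmult_lt_0_compat; lra).
  set (t0 := ln (m * k / (lam + m)) / lam).
  assert (T : (lam + m) * exp (lam * t0) = m * k).
  { unfold t0. replace (lam * (ln (m * k / (lam + m)) / lam)) with (ln (m * k / (lam + m)))
      by (field; lra).
    rewrite exp_ln by (apply Rdiv_lt_0_compat; lra). field. lra. }
  exists (exp (- ((mu - lam) * t0))). split; [apply exp_pos |]. intros M HM t.
  generalize (exp_pos (lam * t)), (exp_pos (mu * t)). intros e1 e2.
  assert (M0 : 0 < M) by (apply Rlt_le_trans with (2 := HM); apply exp_pos).
  destruct (Rle_or_lt t t0) as [L | G].
  - assert (exp (lam * t) <= exp (lam * t0)) by (apply exp_nondecreasing; nra).
    assert (0 <= M * ((mu + m) * exp (mu * t))) by (apply Rmult_le_pos; nra). nra.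
  - assert (X : exp (lam * t) <= M * exp (mu * t)).
    { apply Rle_trans with (exp (- ((mu - lam) * t0)) * exp (mu * t)).
      - rewrite <- exp_plus. apply exp_nondecreasing. nra.
      - apply Rmult_le_compat_r; lra. }
    assert ((lam + m) * exp (lam * t) <= (mu + m) * (M * exp (mu * t)))
      by (apply Rmult_le_compat; lra). lra.
Qed.

(** At [z = c / 2] the quadratic part [c * z - z ^ 2] takes its maximum [c ^ 2 / 4],
    which exceeds the birth rate [rho]; this is where the lower bound on the speed
    comes from. *)
Lemma exists_supersonic_wave :
  4 * rho < c ^ 2 -> delta + H < rho ->
  exists w u, stage w u w /\ is_lim u m_infty 0 /\ is_lim u p_infty k.
Proof.
  intros fast unstable.
  destruct (last_sign_change characteristic (c / 2)) as (lam & lam_range & root & pos).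
  - intros x. apply continuity_pt_filterlim.
    apply (ex_derive_continuous (V := R_NormedModule)). unfold characteristic. now auto_derive.
  - lra.
  - unfold characteristic. rewrite !Rmult_0_l, Ropp_0, exp_0. lra.
  - unfold characteristic.
    assert (exp (- (c / 2 * b)) <= 1) by (rewrite <- exp_0; apply exp_nondecreasing; nra).
    generalize (exp_pos (- (c / 2 * a))). intros. nra.
  - set (mu := Rmin (2 * lam) (c / 2)).
    assert (mu1 : lam < mu) by (apply Rmin_glb_lt; lra).
    assert (mu2 : mu <= 2 * lam) by apply Rmin_l.
    assert (mu3 : mu <= c / 2) by apply Rmin_r.
    assert (chi := pos mu (conj mu1 mu3)).
    destruct (exists_subsolution_coefficient lam mu) as (M0 & M0_pos & HM0); [lra |].
    set (M := Rmax M0 (rho / characteristic mu)).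
    assert (M1 : M0 <= M) by apply Rmax_l.
    apply (exists_factored_wave lam mu M); try lra.
    + apply Rle_div_l; [lra | apply Rmax_r].
    + now apply HM0.
Qed.

(** Differentiating [u' = - m * u + w] and substituting recovers the second-order
    equation, by the choice of [m]. *)
Lemma factored_wave_profile (w u : R -> R) :
  stage w u w -> forall s,
  ex_derive u s /\ ex_derive_n u 2 s /\
  c * Derive u s = Derive_n u 2 s - delta * u s - H * u (s - a)
    + rho * u (s - b) * exp (- u (s - b)).
Proof.
  intros (D & _ & E & _) s.
  assert (D1 : forall t, Derive u t = - m * u t + w t)
    by (intros t; apply is_derive_unique, D).
  assert (D2 : is_derive (Derive u) s
      (- m * (- m * u s + w s) + ((c + m) * w s - feedback u s))).
  { apply is_derive_ext with (fun t => - m * u t + w t); [intros t; symmetry; apply D1 |].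
    apply (is_derive_plus (fun t => - m * u t) w); [| apply E].
    apply (is_derive_scal u), D. }
  split; [eexists; apply D | split].
  - simpl. eexists. exact D2.
  - change (Derive_n u 2 s) with (Derive (Derive u) s).
    rewrite (is_derive_unique _ _ _ D2), D1. unfold feedback.
    replace (- m * (- m * u s + w s) +
      ((c + m) * w s - (rho * (u (s - b) * exp (- u (s - b)))
        + H * (exp (m * a) * u s - u (s - a)))))
    with (u s * (m ^ 2 + c * m) - c * m * u s + c * w s
       - rho * (u (s - b) * exp (- u (s - b)))
        - H * (exp (m * a) * u s - u (s - a))) by ring.
    rewrite m_root. ring.
Qed.

End Factored_profile_equation.

(** At [m = (delta + / sigma) / c] the exponent [m * (c * sigma)] is
    [1 + delta * sigma], and the condition on [sigma0] says precisely that there the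
    linear term [c * m] is at least the right-hand side. *)
Lemma exists_stable_root (delta H sigma sigma0 c : R) :
  0 < delta -> 0 < H -> 0 < c -> 0 < sigma <= sigma0 ->
  H * sigma0 * exp (1 + delta * sigma0) = 1 ->
  exists m, 0 < m /\ m ^ 2 + c * m = delta + H * exp (m * (c * sigma)).
Proof.
  intros delta_pos H_pos c_pos sigma_bounds sigma0_eq.
  set (f := fun m => m ^ 2 + c * m - delta - H * exp (m * (c * sigma))).
  assert (small : H * sigma * exp (1 + delta * sigma) <= 1).
  { rewrite <- sigma0_eq. apply Rmult_le_compat; [nra | left; apply exp_pos | nra |].
    apply exp_nondecreasing. nra. }
  set (m1 := (delta + / sigma) / c).
  assert (is : 0 < / sigma) by (apply Rinv_0_lt_compat; lra).
  assert (m1_pos : 0 < m1) by (apply Rdiv_lt_0_compat; lra).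
  assert (f0 : f 0 < 0).
  { unfold f. rewrite Rmult_0_l, exp_0. nra. }
  assert (f1 : 0 <= f m1).
  { unfold f. replace (m1 * (c * sigma)) with (1 + delta * sigma) by (unfold m1; field; lra).
    replace (c * m1) with (delta + / sigma) by (unfold m1; field; lra).
    assert (H * exp (1 + delta * sigma) <= / sigma); [| nra].
    apply Rmult_le_reg_l with sigma; [lra |]. rewrite Rinv_r by lra. lra. }
  destruct (IVT_cor f 0 m1) as (m & (m0 & _) & fm).
  - intros x. apply continuity_pt_filterlim.
    apply (ex_derive_continuous (V := R_NormedModule)). unfold f. now auto_derive.
  - lra.
  - nra.
  - exists m. unfold f in fm. split; [| lra].
    destruct m0 as [| <-]; [easy | unfold f in f0; lra].
Qed.

Theorem theorem1 (delta rho H sigma0 rstar sigma r : R)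
  (delta_pos : 0 < delta) (rho_pos : 0 < rho) (H_pos : 0 < H)
  (ratio : 1 < rho / (delta + H) <= exp 1)
  (sigma0_pos : 0 < sigma0)
  (sigma0_eq : H * sigma0 * exp (1 + delta * sigma0) = 1)
  (rstar_min : is_r_star delta rho H rstar)
  (sigma_bounds : 0 < sigma <= sigma0)
  (r_bounds : 0 < r < rstar)
  (extra : sigma < r ->
     exists lambda : R,
       0 < lambda /\
       - lambda - delta - H * exp (- sigma * lambda)
         + rho * exp (- r * lambda) = 0 /\
       H > rho * exp (2 * lambda * (sigma - r))) :
  exists cstar : R,
    0 < cstar /\
    forall c : R, c > cstar ->
      exists phi : R -> R,
        traveling_wave delta rho H sigma r c phi /\
        is_lim phi m_infty 0 /\
        is_lim phi p_infty (kappa delta rho H).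
Proof.
  exists (2 * sqrt rho).
  assert (root_pos : 0 < sqrt rho) by now apply sqrt_lt_R0.
  split; [lra |]. intros c c_gt.
  assert (fast : 4 * rho < c ^ 2).
  { rewrite <- (sqrt_sqrt rho) by lra. nra. }
  destruct (exists_stable_root delta H sigma sigma0 c) as (m & m_pos & m_root); trivial; [lra |].
  set (k := kappa delta rho H).
  assert (exp_k : exp k = rho / (delta + H)) by (apply exp_ln; lra).
  assert (k_range : 0 < k <= 1).
  { split.
    - apply exp_lt_inv. rewrite exp_0. lra.
    - apply Rnot_lt_le. intros L. apply exp_increasing in L. lra. }
  assert (k_equilibrium : rho * exp (- k) = delta + H).
  { rewrite exp_Ropp, exp_k. field. lra. }
  assert (unstable : delta + H < rho).
  { destruct ratio as (L & _). apply (Rmult_lt_compat_r (delta + H)) in L; [| lra].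
    replace (rho / (delta + H) * (delta + H)) with rho in L by (field; lra). lra. }
  destruct (exists_supersonic_wave delta rho H c (c * sigma) (c * r) k m)
    as (w & phi & S & lim0 & limk); trivial; try nra.
  exists phi. split; [| now split].
  apply traveling_wave_profile.
  exact (factored_wave_profile delta rho H c (c * sigma) (c * r) k m m_root w phi S).
Qed.
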